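(* Suppose $\phi$ is a positive M-shaped function which satisfies the following decay constraints for $x>0$ and for $x<0$ separately. (For $x>0$) There are $x_0\ge 0$, $0<k<1$ and $D>1$ such that $$\phi'(x)<-D\,\frac{4\sqrt2}{k\sqrt3}\,\phi^{5/4}(x)\quad\text{for all }x>x_0,$$ and for all $x\in[0,x_0]$, $$x_0-x<\frac{\sqrt{\phi(x)}-k\sqrt{\phi(x_0)}}{\sqrt{\frac83}\,P^{3/4}},\qquad P=\max_{y\in[0,x_0]}\phi(y).$$ (For $x<0$) There are $\tilde x_0\ge 0$, $0<\tilde k<1$ and $\tilde D>1$ such that $$\phi'(x)>\tilde D\,\frac{4\sqrt2}{\tilde k\sqrt3}\,\phi^{5/4}(x)\quad\text{for all }x<-\tilde x_0,$$ and for all $x\in[-\tilde x_0,0]$, $$x+\tilde x_0<\frac{\sqrt{\phi(x)}-\tilde k\sqrt{\phi(-\tilde x_0)}}{\sqrt{\frac83}\,\tilde P^{3/4}},\qquad \tilde P=\max_{y\in[-\tilde x_0,0]}\phi(y).$$ Then a unique positive solution exists to $0=f''(x)-f^2(x)+\phi(x)$ for all $x\in\mathbb{R}$.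
   Context: $C_0^\infty(\mathbb{R})$ denotes the space of smooth real-valued functions on $\mathbb{R}$ that decay to zero at $\pm\infty$. A function $\phi\in C_0^\infty\cap L^\infty(\mathbb{R})$ is called M-shaped if there exists an $r>0$ such that for all $|x|>r$ one has $\phi(x)>0$, and $\phi$ is monotonic increasing for $x<-r$ and monotonic decreasing for $x>r$. A positive function is one that is strictly positive for all $x\in\mathbb{R}$. *)

(* Defs.v *)
From Stdlib Require Import Reals.
From Coquelicot Require Import Coquelicot.
Open Scope R_scope.

Definition smooth (phi : R -> R) : Prop :=
  forall (n : nat) (x : R), ex_derive_n phi n x.

(** Here the subscript 0 means decay at infinity, not compact support. *)
Definition C0_infty (phi : R -> R) : Prop :=
  smooth phi /\ is_lim phi p_infty 0 /\ is_lim phi m_infty 0.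

Definition bounded_fun (phi : R -> R) : Prop :=
  exists B : R, forall x : R, Rabs (phi x) <= B.

(** For a continuous function, membership in L^oo(R) is boundedness.
    "Monotonic" is read in the non-strict sense. *)
Definition M_shaped (phi : R -> R) : Prop :=
  C0_infty phi /\ bounded_fun phi /\
  exists r : R, 0 < r /\
    (forall x : R, r < Rabs x -> 0 < phi x) /\
    (forall x y : R, x < y -> y < - r -> phi x <= phi y) /\
    (forall x y : R, r < x -> x < y -> phi y <= phi x).

Definition positive_fun (f : R -> R) : Prop := forall x : R, 0 < f x.

Definition is_max_on (phi : R -> R) (a b P : R) : Prop :=
  (exists y : R, a <= y <= b /\ phi y = P) /\
  (forall y : R, a <= y <= b -> phi y <= P).

(** [Rpower] is the usual real power only for a positive base; below it is
    applied to values and maxima of a positive function. *)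
Definition decay_right (phi : R -> R) : Prop :=
  exists x0 k D P : R,
    0 <= x0 /\ 0 < k < 1 /\ 1 < D /\ is_max_on phi 0 x0 P /\
    (forall x : R, x0 < x ->
       Derive phi x
       < - D * (4 * sqrt 2 / (k * sqrt 3)) * Rpower (phi x) (5 / 4)) /\
    (forall x : R, 0 <= x <= x0 ->
       x0 - x
       < (sqrt (phi x) - k * sqrt (phi x0))
         / (sqrt (8 / 3) * Rpower P (3 / 4))).

Definition decay_left (phi : R -> R) : Prop :=
  exists x0 k D P : R,
    0 <= x0 /\ 0 < k < 1 /\ 1 < D /\ is_max_on phi (- x0) 0 P /\
    (forall x : R, x < - x0 ->
       Derive phi x
       > D * (4 * sqrt 2 / (k * sqrt 3)) * Rpower (phi x) (5 / 4)) /\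
    (forall x : R, - x0 <= x <= 0 ->
       x + x0
       < (sqrt (phi x) - k * sqrt (phi (- x0)))
         / (sqrt (8 / 3) * Rpower P (3 / 4))).

(** [ex_derive_n f 2 x] only says that the total function [Derive f] is
    differentiable at [x], so [ex_derive f x] has to be required as well. *)
Definition is_solution (phi f : R -> R) : Prop :=
  forall x : R,
    ex_derive f x /\ ex_derive_n f 2 x /\
    0 = Derive_n f 2 x - (f x) ^ 2 + phi x.

(* Main.v *)
Require Import Defs.
From Stdlib Require Import Reals Lra FunctionalExtensionality ssreflect.
From Coquelicot Require Import Coquelicot.
Open Scope R_scope.

(** Write the equation as [f'' = f ^ 2 - phi], with [phi] positive, bounded
    and continuous.

    Uniqueness.  If [f] and [g] are positive solutions, [w = f - g] satisfies
    [w'' = (f + g) w], hence [w'' >= w ^ 2] wherever [w > 0], because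
    [f + g > f - g].  A function on the whole line with this property is
    nowhere positive: on a window of half-width [r] around [a] it lies below
    the Keller-Osserman barrier, a multiple of [r ^ 2 / (r ^ 2 - s ^ 2) ^ 2] with
    [s = x - a], whose value at the centre is of order [1 / r ^ 2]
    ([keller_osserman_bound]).  Letting [r] grow gives [f <= g], and the roles
    of [f] and [g] can be exchanged.

    Existence.  If [phi <= l ^ 4 / 4], the constants [0] and [l ^ 2 / 2] are a
    sub- and a supersolution.  Adding [l ^ 2 u] on both sides turns the
    equation into [l ^ 2 u - u'' = h(u)] with [h(u) = l ^ 2 u - u ^ 2 + phi],
    and [h] is nondecreasing in [u] between these constants.  The bounded
    solution of [l ^ 2 v - v'' = h] is [v = (a + b) / (2 l)], where
    [a(x)] is the integral of [exp (- l (x - t)) h(t)] over the past [t <= x]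
    and [b(x)] the mirror integral over the future; they satisfy
    [a' = h - l a] and [b' = l b - h].  Iterating from [u = 0] gives
    nondecreasing bounded sequences [u_n], [a_n], [b_n], which converge
    pointwise.  The three sequences are equi-Lipschitz and [phi] is continuous, so
    the slopes [a_n'] and [b_n'] are equicontinuous at each point, and this suffices to differentiate
    the limits ([derive_of_limit]).  Therefore [u' = (b - a) / 2] and
    [u'' = l ^ 2 u - h(u) = u ^ 2 - phi].  Finally [u > 0], because [a] cannot
    touch zero while its source [h(u) >= phi] is positive. *)

(** * Mean value estimates and derivatives at a maximum *)

Lemma increment_eq_derive (f df : R -> R) (x y : R)
  (hf : forall t, is_derive f t (df t)) :
  exists c, Rmin x y <= c <= Rmax x y /\ f y - f x = df c * (y - x).
Proof.
  apply MVT_gen; intros t _.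
  - apply hf.
  - apply derivable_continuous_pt. exists (df t). apply is_derive_Reals, hf.
Qed.

Lemma le_of_derive_nonneg (f df : R -> R) (x y : R)
  (hf : forall t, is_derive f t (df t)) (hd : forall t, 0 <= df t) (hxy : x <= y) :
  f x <= f y.
Proof.
  destruct (increment_eq_derive f df x y hf) as [c [_ Hc]].
  specialize (hd c). nra.
Qed.

Lemma lipschitz_of_derive_bound (f df : R -> R) (K x y : R)
  (hf : forall t, is_derive f t (df t)) (hd : forall t, Rabs (df t) <= K) :
  Rabs (f y - f x) <= K * Rabs (y - x).
Proof.
  destruct (increment_eq_derive f df x y hf) as [c [_ Hc]].
  rewrite Hc Rabs_mult.
  apply Rmult_le_compat_r; [apply Rabs_pos | apply hd].
Qed.

Lemma derive_pos_values (f : R -> R) (x l : R) (hf : is_derive f x l) (hl : 0 < l) :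
  exists d, 0 < d /\ forall h, h <> 0 -> Rabs h < d -> 0 < (f (x + h) - f x) / h.
Proof.
  apply is_derive_Reals in hf.
  destruct (hf l hl) as [d Hd].
  exists d. split; [apply cond_pos |].
  intros h h0 hh. specialize (Hd h h0 hh).
  apply Rabs_def2 in Hd. lra.
Qed.

Lemma derive_zero_at_max (z : R -> R) (c l d : R) (hz : is_derive z c l)
  (hd : 0 < d) (hmax : forall x, Rabs (x - c) < d -> z x <= z c) : l = 0.
Proof.
  apply is_derive_Reals in hz.
  rewrite <- (deriv_maximum z (c - d) (c + d) c (exist _ l hz)); try lra.
  - reflexivity.
  - intros x h1 h2. apply hmax. apply Rabs_def1; lra.
Qed.

(** If [l > 0], the derivative, which vanishes at [c], is positive just to the
    right of [c], and [z] would exceed its maximum there. *)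
Lemma second_derive_nonpos_at_max (z dz : R -> R) (c l d : R)
  (hz : forall x, is_derive z x (dz x)) (hdz : is_derive dz c l)
  (hd : 0 < d) (hmax : forall x, Rabs (x - c) < d -> z x <= z c) : l <= 0.
Proof.
  assert (H0 : dz c = 0) by (exact (derive_zero_at_max z c _ d (hz c) hd hmax)).
  destruct (Rle_or_lt l 0) as [H | H]; [exact H | exfalso].
  destruct (derive_pos_values dz c l hdz H) as [e [he He]].
  set (h := Rmin (e / 2) (d / 2)).
  assert (0 < h /\ h < e /\ h < d) as [h1 [h2 h3]].
  { unfold h. generalize (Rmin_l (e/2) (d/2)) (Rmin_r (e/2) (d/2)).
    assert (0 < Rmin (e/2) (d/2)) by (apply Rmin_pos; lra). lra. }
  assert (hder : forall t, c <= t <= c + h -> derivable_pt_lim z t (dz t)).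
  { intros t _. apply is_derive_Reals, hz. }
  destruct (MVT_cor2 z dz c (c + h) ltac:(lra) hder) as [t [Ht1 Ht2]].
  specialize (hmax (c + h)). replace (c + h - c) with h in hmax, Ht1 by ring.
  rewrite -> Rabs_pos_eq in hmax by lra. specialize (hmax ltac:(lra)).
  specialize (He (t - c) ltac:(lra)).
  rewrite -> Rabs_pos_eq in He by lra. specialize (He ltac:(lra)).
  replace (c + (t - c)) with t in He by ring. rewrite H0 in He.
  apply (Rmult_lt_compat_r (t - c)) in He; [| lra].
  replace ((dz t - 0) / (t - c) * (t - c)) with (dz t) in He by (field; lra).
  nra.
Qed.

(** * Entire subsolutions of w'' = w^2 are nonpositive *)

(** With [q = r ^ 2 - (x - a) ^ 2], the product [z = w q ^ 2] vanishes at both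
    ends of the window, so its maximum is at an interior point [c].  There
    [z' = 0] eliminates [w'], and [z'' <= 0] becomes
    [w q ^ 2 <= 6 q' ^ 2 - 2 q q''], whose right side is at most [28 r ^ 2].
    Since [z a <= z c], this bounds [w a]. *)
Lemma keller_osserman_bound (w dw ddw : R -> R) (a r : R)
  (h1 : forall x, is_derive w x (dw x)) (h2 : forall x, is_derive dw x (ddw x))
  (hw : forall x, 0 < w x -> w x ^ 2 <= ddw x) (hr : 0 < r) (ha : 0 < w a) :
  w a * r ^ 2 <= 28.
Proof.
  set (q := fun x => r ^ 2 - (x - a) ^ 2).
  set (z := fun x => w x * q x ^ 2).
  set (dz := fun x => dw x * q x ^ 2 - 4 * (x - a) * (w x * q x)).
  assert (Hq : forall x, is_derive q x (- 2 * (x - a))).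
  { intros x. unfold q. auto_derive; [trivial | ring]. }
  assert (Hz : forall x, is_derive z x (dz x)).
  { intros x. unfold z, dz, q. auto_derive.
    - exists (dw x). apply h1.
    - rewrite (is_derive_unique _ _ _ (h1 x)). ring. }
  assert (Hdz : forall x, is_derive dz x
    (ddw x * q x ^ 2 - 8 * (x - a) * dw x * q x + w x * (8 * (x - a) ^ 2 - 4 * q x))).
  { intros x. unfold dz, q. auto_derive.
    - repeat split; trivial; [exists (ddw x); apply h2 | exists (dw x); apply h1].
    - rewrite (is_derive_unique _ _ _ (h1 x)) (is_derive_unique _ _ _ (h2 x)). ring. }
  destruct (continuity_ab_maj z (a - r) (a + r)) as [c [Hc Hcr]]; [lra | |].
  { intros x _. apply derivable_continuous_pt. exists (dz x). apply is_derive_Reals, Hz. }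
  assert (Hza : z a = w a * r ^ 4) by (unfold z, q; ring).
  assert (Hzc : w a * r ^ 4 <= z c) by (rewrite <- Hza; apply Hc; lra).
  assert (Hr4 : 0 < w a * r ^ 4) by (apply Rmult_lt_0_compat; [lra | apply pow_lt; lra]).
  assert (Hqc : 0 < q c).
  { assert (0 <= q c) by (unfold q; nra).
    destruct (Rle_lt_or_eq_dec 0 (q c)) as [H' | H']; [lra | exact H' | ].
    unfold z in Hzc. rewrite <- H' in Hzc. nra. }
  assert (Hwc : 0 < w c).
  { unfold z in Hzc. assert (0 < q c ^ 2) by (apply pow_lt; lra).
    destruct (Rlt_or_le 0 (w c)); [lra | nra]. }
  assert (Hin : a - r < c < a + r) by (unfold q in Hqc; nra).
  set (d := Rmin (c - (a - r)) (a + r - c)).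
  assert (Hd : 0 < d) by (apply Rmin_pos; lra).
  assert (Hmax : forall x, Rabs (x - c) < d -> z x <= z c).
  { intros x Hx. apply Hc.
    generalize (Rmin_l (c - (a - r)) (a + r - c)) (Rmin_r (c - (a - r)) (a + r - c)).
    fold d. apply Rabs_def2 in Hx. lra. }
  assert (E1 := derive_zero_at_max z c _ d (Hz c) Hd Hmax).
  assert (E2 := second_derive_nonpos_at_max z dz c _ d Hz (Hdz c) Hd Hmax).
  unfold dz in E1.
  (* [E1] is this identity multiplied by [q c]. *)
  assert (E3 : dw c * q c = 4 * (c - a) * w c).
  { apply (Rmult_eq_reg_r (q c)); [| lra]. lra. }
  replace (8 * (c - a) * dw c * q c) with (8 * (c - a) * (dw c * q c)) in E2 by ring.
  rewrite E3 in E2.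
  specialize (hw c Hwc).
  assert (E4 : w c * (w c * q c ^ 2) <= w c * (24 * (c - a) ^ 2 + 4 * q c)) by nra.
  apply Rmult_le_reg_l in E4; [| exact Hwc].
  assert (E5 : 24 * (c - a) ^ 2 + 4 * q c <= 28 * r ^ 2) by (unfold q; nra).
  assert (0 < r ^ 2) by (apply pow_lt; lra).
  apply (Rmult_le_reg_r (r ^ 2)); [lra |].
  replace (w a * r ^ 2 * r ^ 2) with (w a * r ^ 4) by ring. unfold z in Hzc. lra.
Qed.

Lemma keller_osserman (w dw ddw : R -> R)
  (h1 : forall x, is_derive w x (dw x)) (h2 : forall x, is_derive dw x (ddw x))
  (hw : forall x, 0 < w x -> w x ^ 2 <= ddw x) (a : R) : w a <= 0.
Proof.
  destruct (Rle_or_lt (w a) 0) as [H | H]; [exact H | exfalso].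
  (* As [w a * r = 28 + w a] and [r > 1], the value [w a * r ^ 2] exceeds [28]. *)
  set (r := 28 / w a + 1).
  assert (Hr : 28 / w a > 0) by (apply Rdiv_lt_0_compat; lra).
  assert (Hb := keller_osserman_bound w dw ddw a r h1 h2 hw ltac:(unfold r; lra) H).
  assert (E : w a * r = 28 + w a) by (unfold r; field; lra).
  assert (r * (w a * r) <= 28) by nra.
  rewrite E in H0. unfold r in H0. nra.
Qed.

(** * Exponentially weighted integrals over the past and the future *)

Definition cont_between (c : R) (h : R -> R) : Prop :=
  forall x, continuous h x /\ 0 <= h x <= c.

Definition weighted_primitive (l : R) (h : R -> R) (x : R) : R :=
  RInt (fun t => exp (l * t) * h t) 0 x.

(** The integral of [exp (l * t) * h t] over the negative half-line.  For
    [h >= 0] it is a supremum over finite intervals, which avoids improper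
    integrals. *)
Definition past_tail (l : R) (h : R -> R) : R :=
  real (Lub_Rbar (fun y => exists z, y = - weighted_primitive l h z)).

Definition past (l : R) (h : R -> R) (x : R) : R :=
  exp (- (l * x)) * (weighted_primitive l h x + past_tail l h).

Definition future (l : R) (h : R -> R) (x : R) : R :=
  past l (fun t => h (- t)) (- x).

Lemma weighted_primitive_derive (l : R) (h : R -> R) (x : R)
  (hh : forall t, continuous h t) :
  is_derive (weighted_primitive l h) x (exp (l * x) * h x).
Proof.
  assert (Hc : forall t, continuous (fun t => exp (l * t) * h t) t).
  { intros t. apply (continuous_mult (fun t => exp (l * t)) h); [| apply hh].
    apply (ex_derive_continuous (fun t => exp (l * t))). auto_derive. trivial. }
  apply (is_derive_RInt (fun t => exp (l * t) * h t) _ 0); [| apply Hc].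
  apply filter_forall. intros y. apply (@RInt_correct R_CompleteNormedModule).
  apply (@ex_RInt_continuous R_CompleteNormedModule). intros t _. apply Hc.
Qed.

Lemma weighted_primitive_mono (l : R) (h1 h2 : R -> R) (x y : R)
  (c1 : forall t, continuous h1 t) (c2 : forall t, continuous h2 t)
  (h12 : forall t, h1 t <= h2 t) (hxy : x <= y) :
  weighted_primitive l h1 y - weighted_primitive l h1 x
  <= weighted_primitive l h2 y - weighted_primitive l h2 x.
Proof.
  set (g := fun t => weighted_primitive l h2 t - weighted_primitive l h1 t).
  assert (g x <= g y); [| unfold g in *; lra].
  apply (le_of_derive_nonneg g (fun t => exp (l * t) * h2 t - exp (l * t) * h1 t)); trivial.
  - intros t. apply: is_derive_minus; apply weighted_primitive_derive; assumption.
  - intros t. specialize (h12 t). generalize (exp_pos (l * t)). nra.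
Qed.

Lemma weighted_primitive_increasing (l c : R) (h : R -> R) (x y : R)
  (hh : cont_between c h) (hxy : x <= y) :
  weighted_primitive l h x <= weighted_primitive l h y.
Proof.
  apply (le_of_derive_nonneg _ (fun t => exp (l * t) * h t)); trivial.
  - intros t. apply weighted_primitive_derive. apply hh.
  - intros t. destruct (hh t). generalize (exp_pos (l * t)). nra.
Qed.

(** For [z <= x] this is the integral of [c * exp (l * t)] from minus infinity;
    for [z > x] the left side is nonpositive.  Being uniform in [z], the bound
    makes the supremum in [past_tail] finite. *)
Lemma weighted_primitive_increment (l c : R) (h : R -> R) (x z : R)
  (hl : 0 < l) (hh : cont_between c h) :
  weighted_primitive l h x - weighted_primitive l h z <= c / l * exp (l * x).
Proof.
  assert (hc : 0 <= c / l).
  { destruct (hh 0). apply Rdiv_le_0_compat; lra. }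
  generalize (exp_pos (l * x)) (exp_pos (l * z)); intros ex ez.
  destruct (Rle_or_lt z x) as [H | H].
  - set (g := fun t => c / l * exp (l * t) - weighted_primitive l h t).
    assert (g z <= g x); [| unfold g in *; nra].
    apply (le_of_derive_nonneg g (fun t => c * exp (l * t) - exp (l * t) * h t)); trivial.
    + intros t. apply: is_derive_minus.
      * auto_derive; [trivial | field; lra].
      * apply weighted_primitive_derive. apply hh.
    + intros t. destruct (hh t). generalize (exp_pos (l * t)). nra.
  - assert (weighted_primitive l h x <= weighted_primitive l h z)
      by (apply weighted_primitive_increasing with c; [assumption | lra]).
    nra.
Qed.

Lemma past_tail_is_lub (l c : R) (h : R -> R) (hl : 0 < l) (hh : cont_between c h) :
  is_lub (fun y => exists z, y = - weighted_primitive l h z) (past_tail l h).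
Proof.
  set (E := fun y => exists z, y = - weighted_primitive l h z).
  destruct (completeness E) as [m Hm].
  - exists (c / l * exp (l * 0)). intros y [z ->].
    generalize (weighted_primitive_increment l c h 0 z hl hh).
    replace (weighted_primitive l h 0) with 0; [lra |].
    unfold weighted_primitive. rewrite RInt_point. reflexivity.
  - exists (- weighted_primitive l h 0). exists 0. reflexivity.
  - unfold past_tail. fold E. rewrite (is_lub_Rbar_unique E (Finite m)); [exact Hm |].
    destruct Hm as [Hm1 Hm2]. split.
    + intros y Hy. apply (Hm1 y Hy).
    + intros [b | |] Hb; simpl; trivial.
      * apply Hm2. exact Hb.
      * apply (Hb (- weighted_primitive l h 0)). exists 0. reflexivity.
Qed.

Lemma past_bounds (l c : R) (h : R -> R) (x : R) (hl : 0 < l) (hh : cont_between c h) :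
  0 <= past l h x <= c / l.
Proof.
  destruct (past_tail_is_lub l c h hl hh) as [H1 H2].
  unfold past. generalize (exp_pos (- (l * x))); intros ep.
  split.
  - apply Rmult_le_pos; [lra |].
    assert (- weighted_primitive l h x <= past_tail l h) by (apply H1; exists x; reflexivity).
    lra.
  - assert (past_tail l h <= c / l * exp (l * x) - weighted_primitive l h x).
    { apply H2. intros y [z ->].
      generalize (weighted_primitive_increment l c h x z hl hh). lra. }
    replace (c / l) with (exp (- (l * x)) * (c / l * exp (l * x))).
    + apply Rmult_le_compat_l; lra.
    + rewrite exp_Ropp. field. split; [lra | apply Rgt_not_eq, exp_pos].
Qed.

Lemma past_derive (l c : R) (h : R -> R) (x : R) (hh : cont_between c h) :
  is_derive (past l h) x (h x - l * past l h x).
Proof.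
  unfold past.
  replace (h x - l * (exp (- (l * x)) * (weighted_primitive l h x + past_tail l h)))
    with (- l * exp (- (l * x)) * (weighted_primitive l h x + past_tail l h)
          + exp (- (l * x)) * (exp (l * x) * h x)).
  - apply (is_derive_mult (fun x => exp (- (l * x)))
             (fun x => weighted_primitive l h x + past_tail l h)).
    + auto_derive; [trivial | ring].
    + rewrite <- (Rplus_0_r (exp (l * x) * h x)).
      apply: is_derive_plus; [| apply: is_derive_const].
      apply weighted_primitive_derive. apply hh.
    + intros; apply Rmult_comm.
  - rewrite exp_Ropp. field. apply Rgt_not_eq, exp_pos.
Qed.

Lemma past_mono (l c : R) (h1 h2 : R -> R) (x : R) (hl : 0 < l)
  (c1 : cont_between c h1) (c2 : cont_between c h2) (h12 : forall t, h1 t <= h2 t) :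
  past l h1 x <= past l h2 x.
Proof.
  destruct (past_tail_is_lub l c h1 hl c1) as [_ L1].
  destruct (past_tail_is_lub l c h2 hl c2) as [U2 _].
  unfold past. apply Rmult_le_compat_l; [left; apply exp_pos |].
  assert (past_tail l h1 <= weighted_primitive l h2 x + past_tail l h2
                            - weighted_primitive l h1 x); [| lra].
  apply L1. intros y [z ->].
  destruct (Rle_or_lt z x) as [H | H].
  - assert (- weighted_primitive l h2 z <= past_tail l h2) by (apply U2; exists z; reflexivity).
    generalize (weighted_primitive_mono l h1 h2 z x (fun t => proj1 (c1 t))
                  (fun t => proj1 (c2 t)) h12 H). lra.
  - assert (- weighted_primitive l h2 x <= past_tail l h2) by (apply U2; exists x; reflexivity).
    generalize (weighted_primitive_increasing l c h1 x z c1 ltac:(lra)). lra.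
Qed.

Lemma cont_between_reflect (c : R) (h : R -> R) (hh : cont_between c h) :
  cont_between c (fun t => h (- t)).
Proof.
  intros x. split; [| apply hh].
  apply (continuous_comp (fun t => - t) h); [| apply hh].
  apply: continuous_opp. apply continuous_id.
Qed.

Lemma future_bounds (l c : R) (h : R -> R) (x : R) (hl : 0 < l) (hh : cont_between c h) :
  0 <= future l h x <= c / l.
Proof. apply past_bounds; [| apply cont_between_reflect]; assumption. Qed.

Lemma future_derive (l c : R) (h : R -> R) (x : R) (hh : cont_between c h) :
  is_derive (future l h) x (l * future l h x - h x).
Proof.
  unfold future.
  replace (l * past l (fun t => h (- t)) (- x) - h x)
    with (-1 * (h (- - x) - l * past l (fun t => h (- t)) (- x)))
    by (rewrite Ropp_involutive; ring).
  apply (is_derive_comp (past l (fun t => h (- t))) (fun x => - x)).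
  - apply (past_derive l c (fun t => h (- t))). apply cont_between_reflect, hh.
  - auto_derive; trivial.
Qed.

Lemma future_mono (l c : R) (h1 h2 : R -> R) (x : R) (hl : 0 < l)
  (c1 : cont_between c h1) (c2 : cont_between c h2) (h12 : forall t, h1 t <= h2 t) :
  future l h1 x <= future l h2 x.
Proof.
  apply past_mono with c; trivial; apply cont_between_reflect; assumption.
Qed.

(** * Differentiating a pointwise limit *)

(** By the mean value theorem the difference quotient of [g n] at [x] is a
    value of [d n] near [x], so by equicontinuity it differs from [d n x] by at
    most [eps / 2], uniformly in [n]; this estimate passes to the limit. *)
Lemma derive_of_limit (g d : nat -> R -> R) (G : R -> R) (x s : R)
  (hg : forall n t, is_derive (g n) t (d n t))
  (hG : forall t, is_lim_seq (fun n => g n t) (G t))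
  (hs : is_lim_seq (fun n => d n x) s)
  (heq : forall eps, 0 < eps -> exists del, 0 < del /\
     forall n y, Rabs (y - x) < del -> Rabs (d n y - d n x) <= eps) :
  is_derive G x s.
Proof.
  apply is_derive_Reals. intros eps heps.
  destruct (heq (eps / 2) ltac:(lra)) as [del [hdel H]].
  exists (mkposreal del hdel). simpl. intros h h0 hh.
  apply Rle_lt_trans with (eps / 2); [| lra].
  assert (L : is_lim_seq (fun n => Rabs ((g n (x + h) - g n x) / h - d n x))
                (Rabs ((G (x + h) - G x) / h - s))).
  { apply (is_lim_seq_abs _ (Finite ((G (x + h) - G x) / h - s))).
    apply is_lim_seq_minus'; [| exact hs].
    apply (is_lim_seq_scal_r _ (/ h) (Finite (G (x + h) - G x))).
    apply is_lim_seq_minus'; apply hG. }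
  refine (is_lim_seq_le _ (fun _ => eps / 2) (Finite _) (Finite _) _ L _).
  - intros n.
    destruct (increment_eq_derive (g n) (d n) x (x + h) (hg n)) as [c [Hc E]].
    rewrite E. replace (d n c * (x + h - x) / h - d n x) with (d n c - d n x) by (field; exact h0).
    apply H. apply Rle_lt_trans with (Rabs h); [| exact hh].
    revert Hc. unfold Rmin, Rmax. destruct (Rle_dec x (x + h)); intros.
    + rewrite -> !Rabs_pos_eq by lra. lra.
    + rewrite -> !Rabs_left1 by lra. lra.
  - apply is_lim_seq_const.
Qed.

(** * Monotone iteration *)

(** The right side of [l ^ 2 u - u'' = reaction l phi u]; the shift [l ^ 2 u]
    makes it nondecreasing in [u] on the interval from [0] to [l ^ 2 / 2]. *)
Definition reaction (l : R) (phi u : R -> R) (x : R) : R :=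
  l ^ 2 * u x - u x ^ 2 + phi x.

Fixpoint approx (l : R) (phi : R -> R) (n : nat) : R -> R :=
  match n with
  | O => fun _ => 0
  | S m => fun x => (past l (reaction l phi (approx l phi m)) x
                     + future l (reaction l phi (approx l phi m)) x) / (2 * l)
  end.

Definition past_approx (l : R) (phi : R -> R) (n : nat) : R -> R :=
  past l (reaction l phi (approx l phi n)).

Definition future_approx (l : R) (phi : R -> R) (n : nat) : R -> R :=
  future l (reaction l phi (approx l phi n)).

(** At the upper constant [m = l ^ 2 / 2] one has [m ^ 2 = l ^ 4 / 4 >= phi],
    so the reaction there is at most [l ^ 2 * m = l ^ 4 / 2]. *)
Lemma reaction_between (l : R) (phi u : R -> R)
  (hphi : cont_between (l ^ 4 / 4) phi) (hu : cont_between (l ^ 2 / 2) u) :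
  cont_between (l ^ 4 / 2) (reaction l phi u).
Proof.
  intros x. destruct (hphi x) as [cp bp], (hu x) as [cu bu]. split.
  - unfold reaction. apply: continuous_plus; [| exact cp].
    apply: continuous_minus.
    + apply: continuous_mult; [apply continuous_const | exact cu].
    + apply (continuous_ext (fun x => u x * u x)); [intros t; change (u t * u t = u t ^ 2); ring |].
      apply: continuous_mult; exact cu.
  - unfold reaction. replace (l ^ 4) with (l ^ 2 * l ^ 2) in * by ring.
    set (m := l ^ 2) in *. nra.
Qed.

Lemma reaction_mono (l : R) (phi u v : R -> R) (x : R)
  (hu : cont_between (l ^ 2 / 2) u) (hv : cont_between (l ^ 2 / 2) v) (huv : u x <= v x) :
  reaction l phi u x <= reaction l phi v x.
Proof.
  destruct (hu x) as [_ bu], (hv x) as [_ bv].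
  unfold reaction. nra.
Qed.

(** A source at most [l ^ 4 / 2] gives integrals over the past and the future
    of at most [l ^ 3 / 2], so their sum divided by [2 * l] is again at most
    [l ^ 2 / 2]. *)
Lemma approx_between (l : R) (phi : R -> R) (n : nat) (hl : 0 < l)
  (hphi : cont_between (l ^ 4 / 4) phi) :
  cont_between (l ^ 2 / 2) (approx l phi n).
Proof.
  induction n as [| n IH]; intros x.
  - split; [apply continuous_const |]. simpl. nra.
  - assert (H := reaction_between l phi _ hphi IH). split.
    + simpl. apply: continuous_mult; [| apply continuous_const].
      apply: continuous_plus; apply: ex_derive_continuous; eexists.
      * apply (past_derive l _ _ x H).
      * apply (future_derive l _ _ x H).
    + generalize (past_bounds l _ _ x hl H) (future_bounds l _ _ x hl H). intros B1 B2.
      change (approx l phi (S n) x)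
        with ((past l (reaction l phi (approx l phi n)) x
               + future l (reaction l phi (approx l phi n)) x) / (2 * l)).
      split; [apply Rdiv_le_0_compat; lra |].
      replace (l ^ 2 / 2) with ((l ^ 4 / 2 / l + l ^ 4 / 2 / l) / (2 * l)) by (field; lra).
      apply Rmult_le_compat_r; [left; apply Rinv_0_lt_compat |]; lra.
Qed.

Lemma approx_mono (l : R) (phi : R -> R) (n : nat) (x : R) (hl : 0 < l)
  (hphi : cont_between (l ^ 4 / 4) phi) :
  approx l phi n x <= approx l phi (S n) x.
Proof.
  revert x. induction n as [| n IH]; intros x.
  - apply (approx_between l phi 1 hl hphi).
  - change ((past_approx l phi n x + future_approx l phi n x) / (2 * l)
      <= (past_approx l phi (S n) x + future_approx l phi (S n) x) / (2 * l)).
    assert (B : forall k, cont_between (l ^ 4 / 2) (reaction l phi (approx l phi k)))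
      by (intros k; apply reaction_between, approx_between; assumption).
    assert (M : forall t, reaction l phi (approx l phi n) t
                          <= reaction l phi (approx l phi (S n)) t)
      by (intros t; apply reaction_mono; try apply approx_between; auto).
    apply Rmult_le_compat_r; [left; apply Rinv_0_lt_compat; lra |].
    apply Rplus_le_compat.
    + apply past_mono with (l ^ 4 / 2); auto.
    + apply future_mono with (l ^ 4 / 2); auto.
Qed.

Lemma bounded_monotone_limit (u : nat -> R -> R) (c : R)
  (hu : forall n x, 0 <= u n x <= c) (hm : forall n x, u n x <= u (S n) x) :
  exists U : R -> R, (forall x, is_lim_seq (fun n => u n x) (U x))
                     /\ (forall x, 0 <= U x <= c).
Proof.
  exists (fun x => real (Lim_seq (fun n => u n x))).
  assert (L : forall x, is_lim_seq (fun n => u n x) (real (Lim_seq (fun n => u n x)))).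
  { intros x. apply Lim_seq_correct'.
    apply ex_finite_lim_seq_incr with c; intros n; [apply hm | apply hu]. }
  split; [exact L |]. intros x. split.
  - apply (is_lim_seq_le (fun _ => 0) (fun n => u n x) (Finite 0) (Finite (real (Lim_seq (fun n => u n x)))));
      [intros n; apply hu | apply is_lim_seq_const | apply L].
  - apply (is_lim_seq_le (fun n => u n x) (fun _ => c) (Finite (real (Lim_seq (fun n => u n x)))) (Finite c));
      [intros n; apply hu | apply L | apply is_lim_seq_const].
Qed.

(** * Equicontinuity of the iterates *)

(** The slope [h - l * a] is a difference of two quantities that both lie
    between [0] and [l ^ 4 / 2]. *)
Lemma past_approx_lipschitz (l : R) (phi : R -> R) (n : nat) (x y : R) (hl : 0 < l)
  (hphi : cont_between (l ^ 4 / 4) phi) :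
  Rabs (past_approx l phi n y - past_approx l phi n x) <= l ^ 4 / 2 * Rabs (y - x).
Proof.
  assert (B := reaction_between l phi _ hphi (approx_between l phi n hl hphi)).
  apply (lipschitz_of_derive_bound _ _ _ x y (fun t => past_derive l _ _ t B)).
  intros t. destruct (B t) as [_ Bt]. destruct (past_bounds l _ _ t hl B) as [P1 P2].
  apply (Rmult_le_compat_l l) in P2; [| lra].
  replace (l * (l ^ 4 / 2 / l)) with (l ^ 4 / 2) in P2 by (field; lra).
  apply Rabs_le. nra.
Qed.

Lemma future_approx_lipschitz (l : R) (phi : R -> R) (n : nat) (x y : R) (hl : 0 < l)
  (hphi : cont_between (l ^ 4 / 4) phi) :
  Rabs (future_approx l phi n y - future_approx l phi n x) <= l ^ 4 / 2 * Rabs (y - x).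
Proof.
  assert (B := reaction_between l phi _ hphi (approx_between l phi n hl hphi)).
  apply (lipschitz_of_derive_bound _ _ _ x y (fun t => future_derive l _ _ t B)).
  intros t. destruct (B t) as [_ Bt]. destruct (future_bounds l _ _ t hl B) as [P1 P2].
  apply (Rmult_le_compat_l l) in P2; [| lra].
  replace (l * (l ^ 4 / 2 / l)) with (l ^ 4 / 2) in P2 by (field; lra).
  apply Rabs_le. nra.
Qed.

Lemma approx_lipschitz (l : R) (phi : R -> R) (n : nat) (x y : R) (hl : 0 < l)
  (hphi : cont_between (l ^ 4 / 4) phi) :
  Rabs (approx l phi n y - approx l phi n x) <= l ^ 3 / 2 * Rabs (y - x).
Proof.
  destruct n as [| n].
  - simpl. rewrite Rminus_0_r Rabs_R0.
    apply Rmult_le_pos; [| apply Rabs_pos].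
    assert (0 < l ^ 3) by (apply pow_lt; lra). simpl in *. lra.
  - change (Rabs ((past_approx l phi n y + future_approx l phi n y) / (2 * l)
      - (past_approx l phi n x + future_approx l phi n x) / (2 * l))
      <= l ^ 3 / 2 * Rabs (y - x)).
    replace ((past_approx l phi n y + future_approx l phi n y) / (2 * l)
      - (past_approx l phi n x + future_approx l phi n x) / (2 * l))
      with (((past_approx l phi n y - past_approx l phi n x)
             + (future_approx l phi n y - future_approx l phi n x)) * / (2 * l))
      by (field; lra).
    assert (Hi : 0 < / (2 * l)) by (apply Rinv_0_lt_compat; lra).
    rewrite Rabs_mult (Rabs_pos_eq (/ (2 * l))); [| lra].
    replace (l ^ 3 / 2 * Rabs (y - x))
      with ((l ^ 4 / 2 * Rabs (y - x) + l ^ 4 / 2 * Rabs (y - x)) * / (2 * l))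
      by (field; lra).
    apply Rmult_le_compat_r; [lra |].
    eapply Rle_trans; [apply Rabs_triang |].
    apply Rplus_le_compat; [apply past_approx_lipschitz | apply future_approx_lipschitz];
      assumption.
Qed.

(** [phi] need not be Lipschitz, so its own oscillation stays in the bound; what
    matters is that the right side does not depend on [n]. *)
Lemma reaction_approx_modulus (l : R) (phi : R -> R) (n : nat) (x y : R) (hl : 0 < l)
  (hphi : cont_between (l ^ 4 / 4) phi) :
  Rabs (reaction l phi (approx l phi n) y - reaction l phi (approx l phi n) x)
  <= l ^ 5 / 2 * Rabs (y - x) + Rabs (phi y - phi x).
Proof.
  destruct (approx_between l phi n hl hphi x) as [_ Bx].
  destruct (approx_between l phi n hl hphi y) as [_ By].
  assert (L := approx_lipschitz l phi n x y hl hphi).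
  unfold reaction. set (u := approx l phi n) in *.
  replace (l ^ 2 * u y - u y ^ 2 + phi y - (l ^ 2 * u x - u x ^ 2 + phi x))
    with ((l ^ 2 - (u x + u y)) * (u y - u x) + (phi y - phi x)) by ring.
  eapply Rle_trans; [apply Rabs_triang |]. apply Rplus_le_compat_r.
  rewrite Rabs_mult (Rabs_pos_eq (l ^ 2 - _)); [| lra].
  replace (l ^ 5 / 2 * Rabs (y - x)) with (l ^ 2 * (l ^ 3 / 2 * Rabs (y - x))) by field.
  apply Rmult_le_compat; try lra. apply Rabs_pos.
Qed.

Lemma slope_modulus (l h1 h2 a1 a2 s e : R) (hl : 0 < l)
  (hh : Rabs (h2 - h1) <= l ^ 5 / 2 * s + e) (ha : Rabs (a2 - a1) <= l ^ 4 / 2 * s) :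
  Rabs (h2 - l * a2 - (h1 - l * a1)) <= l ^ 5 * s + e.
Proof.
  replace (h2 - l * a2 - (h1 - l * a1)) with ((h2 - h1) + - (l * (a2 - a1))) by ring.
  eapply Rle_trans; [apply Rabs_triang |].
  rewrite Rabs_Ropp Rabs_mult (Rabs_pos_eq l); [| lra].
  apply (Rmult_le_compat_l l) in ha; [| lra].
  replace (l * (l ^ 4 / 2 * s)) with (l ^ 5 / 2 * s) in ha by field.
  lra.
Qed.

Lemma equicontinuous_of_modulus (d : nat -> R -> R) (phi : R -> R) (K x : R)
  (hK : 0 < K) (hphi : continuous phi x)
  (hd : forall n y, Rabs (d n y - d n x) <= K * Rabs (y - x) + Rabs (phi y - phi x)) :
  forall eps, 0 < eps -> exists del, 0 < del /\
     forall n y, Rabs (y - x) < del -> Rabs (d n y - d n x) <= eps.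
Proof.
  intros eps heps.
  destruct (proj1 (filterlim_locally phi (phi x)) hphi (mkposreal (eps / 2) ltac:(lra)))
    as [del Hdel].
  exists (Rmin del (eps / 2 / K)). split.
  - apply Rmin_pos; [apply cond_pos |]. apply Rdiv_lt_0_compat; lra.
  - intros n y Hy.
    assert (H1 := Rlt_le_trans _ _ _ Hy (Rmin_l _ _)).
    assert (H2 := Rlt_le_trans _ _ _ Hy (Rmin_r _ _)).
    specialize (Hdel y H1). unfold ball in Hdel; simpl in Hdel.
    unfold AbsRing_ball, abs, minus, plus, opp in Hdel; simpl in Hdel.
    apply (Rmult_lt_compat_l K) in H2; [| exact hK].
    replace (K * (eps / 2 / K)) with (eps / 2) in H2 by (field; lra).
    specialize (hd n y). unfold Rminus in *. lra.
Qed.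

(** * Existence *)

(** A zero of the nonnegative [a] is a minimum, where [a' = 0]; the equation
    gives [a' = h > 0] there. *)
Lemma positive_of_relaxation (a h : R -> R) (l x : R)
  (ha : forall t, is_derive a t (h t - l * a t)) (h0 : forall t, 0 < h t)
  (a0 : forall t, 0 <= a t) : 0 < a x.
Proof.
  destruct (Rle_lt_or_eq_dec 0 (a x) (a0 x)) as [H | H]; [exact H | exfalso].
  assert (E : - (h x - l * a x) = 0).
  { apply (derive_zero_at_max (fun t => - a t) x _ 1); [| lra |].
    - apply: is_derive_opp. apply ha.
    - intros t _. specialize (a0 t). lra. }
  rewrite <- H in E. specialize (h0 x). lra.
Qed.

Lemma positive_solution_exists (phi : R -> R) (l : R) (hl : 0 < l)
  (hphi : cont_between (l ^ 4 / 4) phi) (hpos : forall x, 0 < phi x) :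
  exists u du : R -> R, (forall x, 0 < u x) /\
    (forall x, is_derive u x (du x)) /\
    (forall x, is_derive du x (u x ^ 2 - phi x)).
Proof.
  assert (Bu := fun n => approx_between l phi n hl hphi).
  assert (Bh := fun n => reaction_between l phi _ hphi (Bu n)).
  assert (Mh : forall n x, reaction l phi (approx l phi n) x
                           <= reaction l phi (approx l phi (S n)) x)
    by (intros n x; apply reaction_mono; trivial; apply approx_mono; assumption).
  destruct (bounded_monotone_limit (approx l phi) (l ^ 2 / 2)) as [u [Lu Pu]].
  { intros n x. apply (Bu n x). }
  { intros n x. apply approx_mono; assumption. }
  destruct (bounded_monotone_limit (past_approx l phi) (l ^ 4 / 2 / l)) as [a [La Pa]].
  { intros n x. apply past_bounds; auto. }
  { intros n x. apply past_mono with (l ^ 4 / 2); auto. }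
  destruct (bounded_monotone_limit (future_approx l phi) (l ^ 4 / 2 / l)) as [b [Lb Pb]].
  { intros n x. apply future_bounds; auto. }
  { intros n x. apply future_mono with (l ^ 4 / 2); auto. }
  assert (Lh : forall x, is_lim_seq (fun n => reaction l phi (approx l phi n) x)
                                    (reaction l phi u x)).
  { intros x. unfold reaction.
    apply is_lim_seq_plus'; [| apply is_lim_seq_const].
    apply is_lim_seq_minus'.
    - apply (is_lim_seq_scal_l _ (l ^ 2) (Finite (u x))), Lu.
    - apply (is_lim_seq_ext (fun n => approx l phi n x * approx l phi n x)).
      { intros n; ring. }
      replace (u x ^ 2) with (u x * u x) by ring.
      apply is_lim_seq_mult'; apply Lu. }
  assert (Eu : forall x, u x = (a x + b x) / (2 * l)).
  { intros x.
    assert (L1 : is_lim_seq (fun n => approx l phi (S n) x) (u x))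
      by (apply (proj1 (is_lim_seq_incr_1 (fun n => approx l phi n x) (u x))), Lu).
    assert (L2 : is_lim_seq (fun n => approx l phi (S n) x) ((a x + b x) / (2 * l))).
    { apply (is_lim_seq_scal_r _ (/ (2 * l)) (Finite (a x + b x))).
      apply is_lim_seq_plus'; [apply La | apply Lb]. }
    apply is_lim_seq_unique in L1. apply is_lim_seq_unique in L2. congruence. }
  assert (hl5 : 0 < l ^ 5) by (apply pow_lt; exact hl).
  assert (Da : forall x, is_derive a x (reaction l phi u x - l * a x)).
  { intros x.
    set (d := fun n t => reaction l phi (approx l phi n) t - l * past_approx l phi n t).
    apply (derive_of_limit (past_approx l phi) d).
    - intros n t. apply (past_derive l _ _ t (Bh n)).
    - exact La.
    - apply is_lim_seq_minus'; [apply Lh |].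
      apply (is_lim_seq_scal_l _ l (Finite (a x))), La.
    - apply (equicontinuous_of_modulus d phi (l ^ 5)); [exact hl5 | apply hphi |].
      intros n y.
      apply slope_modulus; [lra | apply reaction_approx_modulus | apply past_approx_lipschitz];
        assumption. }
  assert (Db : forall x, is_derive b x (l * b x - reaction l phi u x)).
  { intros x.
    set (d := fun n t => l * future_approx l phi n t - reaction l phi (approx l phi n) t).
    apply (derive_of_limit (future_approx l phi) d).
    - intros n t. apply (future_derive l _ _ t (Bh n)).
    - exact Lb.
    - apply is_lim_seq_minus'; [| apply Lh].
      apply (is_lim_seq_scal_l _ l (Finite (b x))), Lb.
    - apply (equicontinuous_of_modulus d phi (l ^ 5)); [exact hl5 | apply hphi |].
      intros n y. rewrite -Rabs_Ropp.
      replace (- (d n y - d n x))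
        with (reaction l phi (approx l phi n) y - l * future_approx l phi n y
              - (reaction l phi (approx l phi n) x - l * future_approx l phi n x))
        by (unfold d; ring).
      apply slope_modulus; [lra | apply reaction_approx_modulus | apply future_approx_lipschitz];
        assumption. }
  exists u, (fun x => (b x - a x) / 2). split; [| split].
  - intros x. rewrite Eu.
    assert (0 < a x).
    { apply (positive_of_relaxation a (reaction l phi u) l x Da); [| apply Pa].
      intros t. unfold reaction. specialize (hpos t). specialize (Pu t). nra. }
    destruct (Pb x). apply Rdiv_lt_0_compat; lra.
  - intros x. apply (is_derive_ext (fun t => (a t + b t) / (2 * l))).
    { intros t. symmetry. apply Eu. }
    evar_last.
    + apply: is_derive_mult; [apply: is_derive_plus; [apply Da | apply Db] | apply: is_derive_const | ].
      intros; apply Rmult_comm.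
    + unfold plus, mult, zero; simpl. field. lra.
  - intros x. evar_last.
    + apply: is_derive_mult; [apply: is_derive_minus; [apply Db | apply Da] | apply: is_derive_const | ].
      intros; apply Rmult_comm.
    + unfold minus, plus, opp, mult, zero; simpl. unfold reaction. rewrite Eu. field. lra.
Qed.

(** * Uniqueness and conclusion *)

Lemma solution_derivatives (phi f : R -> R) (hf : is_solution phi f) (x : R) :
  is_derive f x (Derive f x) /\ is_derive (Derive f) x (f x ^ 2 - phi x).
Proof.
  destruct (hf x) as [H1 [H2 H3]]. split.
  - apply Derive_correct, H1.
  - replace (f x ^ 2 - phi x) with (Derive (Derive f) x).
    + apply Derive_correct. exact H2.
    + change (Derive_n f 2 x) with (Derive (Derive f) x) in H3. lra.
Qed.

(** For [w = f - g > 0], positivity of [g] gives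
    [w'' = (f + g) w >= (f - g) w = w ^ 2]. *)
Lemma positive_solutions_le (phi f g : R -> R)
  (f0 : positive_fun f) (g0 : positive_fun g)
  (hf : is_solution phi f) (hg : is_solution phi g) (x : R) : f x <= g x.
Proof.
  assert (f x - g x <= 0); [| lra].
  apply (keller_osserman (fun t => f t - g t) (fun t => Derive f t - Derive g t)
           (fun t => (f t ^ 2 - phi t) - (g t ^ 2 - phi t))).
  - intros t. apply: is_derive_minus; apply (solution_derivatives phi); assumption.
  - intros t. apply: is_derive_minus; apply (solution_derivatives phi); assumption.
  - intros t ht. specialize (f0 t). specialize (g0 t). simpl in *. nra.
Qed.

Theorem theorem39 (phi : R -> R)
  (hpos : positive_fun phi)
  (hM : M_shaped phi)
  (hright : decay_right phi)
  (hleft : decay_left phi) :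
  exists! f : R -> R, positive_fun f /\ is_solution phi f.
Proof.
  destruct hM as [[hsm _] [[B hB] _]].
  assert (HB : forall x, 0 < phi x <= B).
  { intros x. split; [apply hpos |]. specialize (hB x). apply Rabs_le_between in hB. lra. }
  assert (B0 : 0 < B) by (generalize (HB 0); lra).
  (* [l = B + 2] satisfies [B <= l ^ 4 / 4]. *)
  destruct (positive_solution_exists phi (B + 2)) as [u [du [Pu [Du Ddu]]]]; [lra | | exact hpos |].
  { intros x. split.
    - apply: ex_derive_continuous. apply (hsm 1%nat x).
    - destruct (HB x). split; [lra |].
      replace ((B + 2) ^ 4) with (((B + 2) ^ 2) ^ 2) by ring.
      assert (4 * (B + 1) <= (B + 2) ^ 2) by nra. nra. }
  assert (Edu : Derive u = du).
  { apply functional_extensionality. intros x. apply is_derive_unique, Du. }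
  assert (Su : is_solution phi u).
  { intros x. split; [exists (du x); apply Du |].
    change (ex_derive (Derive u) x /\ 0 = Derive (Derive u) x - u x ^ 2 + phi x).
    rewrite Edu. split; [eexists; apply Ddu |].
    rewrite (is_derive_unique _ _ _ (Ddu x)). ring. }
  exists u. split; [split; assumption |].
  intros f [Pf Sf]. apply functional_extensionality. intros x.
  apply Rle_antisym; apply (positive_solutions_le phi); assumption.
Qed.
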